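(* Let $\Omega_D\subseteq\mathbb{H}$ be a slice domain and let $f:\Omega_{D}\to\hat{\mathbb{H}}=\mathbb{H}\cup\{\infty\}$ be a non-constant semiregular function. Let $K\subset D$ be a compact set containing an accumulation point. Then $\mathcal{P}(f)_{\mathbb{C}}\cap K$ is finite.
   Context: $\mathbb{H}$ denotes the quaternions with conjugation $x^c$, $\mathbb{S}=\{I\in\mathbb{H}: I^2=-1\}$, $\mathbb{C}_I=\mathbb{R}+I\mathbb{R}$. Let $\mathbb{H}_{\mathbb{C}}=\mathbb{H}\otimes_{\mathbb{R}}\mathbb{C}=\{p+\imath q: p,q\in\mathbb{H}\}$ with product $(p_1+\imath q_1)(p_2+\imath q_2)=p_1p_2-q_1q_2+\imath(p_1q_2+q_1p_2)$ and $\overline{p+\imath q}=p-\imath q$. For an open $D\subseteq\mathbb{C}$ symmetric under complex conjugation, $\Omega_D=\{\alpha+I\beta:\alpha+i\beta\in D, I\in\mathbb{S}\}$; it is assumed to be a domain, and is a slice domain if $D\cap\mathbb{R}\neq\emptyset$. A stem function is $F=F_1+\imath F_2:D\to\mathbb{H}_{\mathbb{C}}$ with $F(\bar z)=\overline{F(z)}$; it induces the slice function $f=\mathcal{I}(F)$, $f(\alpha+I\beta)=F_1(\alpha+i\beta)+IF_2(\alpha+i\beta)$. $f$ is regular if $F$ is $C^1$ and $\partial F/\partial\alpha+\imath\,\partial F/\partial\beta=0$. The slice product is $\mathcal{I}(F)*\mathcal{I}(G)=\mathcal{I}(FG)$, the slice conjugate $f^c=\mathcal{I}(F_1^c+\imath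 F_2^c)$, $f^s=f^c*f$, the slice reciprocal $f^{-*}=(f^s)^{-1}f^c$ off the zeros of $f^s$; $(x-q)^{*n}$ denotes the $n$-th $*$-power, $n\in\mathbb{Z}$. Poles. For $q=\alpha+I\beta$ and $R>0$ let $A_I(q,0,R)=\{z\in\mathbb{C}_I: 0<|z-q|<R\}$, let $\Omega(q,0,R)=\{u+Jv: J\in\mathbb{S},\ 0<|u+iv-(\alpha+i\beta)|<R,\ 0<|u+iv-(\alpha-i\beta)|<R\}$ and $\Sigma(q,0,R)=\Omega(q,0,R)\cup A_I(q,0,R)$. If $f$ is regular on a circular open set containing $\Sigma(q,0,R)$ for some $R>0$, then $q$ is a singularity of $f$ and $f$ has a unique Laurent expansion $f(x)=\sum_{n\in\mathbb{Z}}(x-q)^{*n}a_n$ on $\Sigma(q,0,R)$, $a_n\in\mathbb{H}$. The singularity is removable if $f$ extends to a neighborhood of $q$ as a regular function; otherwise $q$ is a pole if there is $m\geq0$ with $a_{-k}=0$ for all $k>m$. A function on $\Omega_D$ is semiregular if it is regular on some circular open $\Omega_{D'}\subset\Omega_D$ and every point of $\Omega_D\setminus\Omega_{D'}$ is a pole or a removable singularity; it is given the value $\infty$ at poles. $\mathcal{P}(f)$ is the set of poles of $f$. For $V\subset\mathbb{H}$, $V_{\mathbb{C}}=\{\alpha+i\beta\in\mathbb{C}:\alpha+I\beta\in V\text{ for some }I\in\mathbb{S}\}$. *)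

(* Defs.v *)
From HB Require Import structures.
From mathcomp Require Import all_boot all_order all_algebra.
From mathcomp Require Import ring.
From mathcomp Require Import all_classical all_reals all_analysis.
From mathcomp Require Import complex.

Set Implicit Arguments.
Unset Strict Implicit.
Unset Printing Implicit Defensive.

Import Order.TTheory GRing.Theory Num.Theory.
Import numFieldNormedType.Exports.

Local Open Scope classical_set_scope.
Local Open Scope ring_scope.

(* The regular module [R[i]^o] is the type that carries the topology of the
   complex plane in MathComp-Analysis. *)
Notation C R := (R[i]^o).

(** * Quaternions *)

(* a + b i + c j + d k *)
Record quat (R : realType) : Type := Quat { qr : R; qi : R; qj : R; qk : R }.

Section Quaternions.
Variable R : realType.
Implicit Types x y : quat R.

Definition quat_to_prod x := (qr x, qi x, qj x, qk x).
Definition quat_of_prod (t : R * R * R * R) : quat R :=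
  Quat t.1.1.1 t.1.1.2 t.1.2 t.2.

Lemma quat_to_prodK : cancel quat_to_prod quat_of_prod.
Proof. by case. Qed.

HB.instance Definition _ := Choice.copy (quat R) (can_type quat_to_prodK).

Lemma quat_eq x y :
  qr x = qr y -> qi x = qi y -> qj x = qj y -> qk x = qk y -> x = y.
Proof. by case: x y => ? ? ? ? [? ? ? ?] /= -> -> -> ->. Qed.

Definition qzero : quat R := Quat 0 0 0 0.
Definition qopp x : quat R := Quat (- qr x) (- qi x) (- qj x) (- qk x).
Definition qadd x y : quat R :=
  Quat (qr x + qr y) (qi x + qi y) (qj x + qj y) (qk x + qk y).

Lemma qaddA : associative qadd.
Proof. by move=> x y z; apply: quat_eq => /=; ring. Qed.
Lemma qaddC : commutative qadd.
Proof. by move=> x y; apply: quat_eq => /=; ring. Qed.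
Lemma qadd0q : left_id qzero qadd.
Proof. by move=> x; apply: quat_eq => /=; ring. Qed.
Lemma qaddNq : left_inverse qzero qopp qadd.
Proof. by move=> x; apply: quat_eq => /=; ring. Qed.

HB.instance Definition _ :=
  GRing.isZmodule.Build (quat R) qaddA qaddC qadd0q qaddNq.

Definition qone : quat R := Quat 1 0 0 0.
Definition qmul x y : quat R := Quat
  (qr x * qr y - qi x * qi y - qj x * qj y - qk x * qk y)
  (qr x * qi y + qi x * qr y + qj x * qk y - qk x * qj y)
  (qr x * qj y - qi x * qk y + qj x * qr y + qk x * qi y)
  (qr x * qk y + qi x * qj y - qj x * qi y + qk x * qr y).

Lemma qmulA : associative qmul.
Proof. by move=> x y z; apply: quat_eq => /=; ring. Qed.
Lemma qmul1q : left_id qone qmul.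
Proof. by move=> x; apply: quat_eq => /=; ring. Qed.
Lemma qmulq1 : right_id qone qmul.
Proof. by move=> x; apply: quat_eq => /=; ring. Qed.
Lemma qmulDl : left_distributive qmul +%R.
Proof. by move=> x y z; apply: quat_eq => /=; ring. Qed.
Lemma qmulDr : right_distributive qmul +%R.
Proof. by move=> x y z; apply: quat_eq => /=; ring. Qed.
Lemma qone_neq0 : qone != 0.
Proof. by apply/eqP => -[] /eqP; rewrite oner_eq0. Qed.

HB.instance Definition _ := GRing.Zmodule_isNzRing.Build (quat R)
  qmulA qmul1q qmulq1 qmulDl qmulDr qone_neq0.

Definition qscale (k : R) x : quat R :=
  Quat (k * qr x) (k * qi x) (k * qj x) (k * qk x).

Lemma qscaleA k l x : qscale k (qscale l x) = qscale (k * l) x.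
Proof. by apply: quat_eq => /=; ring. Qed.
Lemma qscale1 : left_id 1 qscale.
Proof. by move=> x; apply: quat_eq => /=; ring. Qed.
Lemma qscaleDr : right_distributive qscale +%R.
Proof. by move=> k x y; apply: quat_eq => /=; ring. Qed.
Lemma qscaleDl x : {morph qscale^~ x : k l / k + l}.
Proof. by move=> k l; apply: quat_eq => /=; ring. Qed.

HB.instance Definition _ := GRing.Zmodule_isLmodule.Build R (quat R)
  qscaleA qscale1 qscaleDr qscaleDl.

Lemma qscaleAl (k : R) x y : k *: (x * y) = (k *: x) * y.
Proof. by apply: quat_eq => /=; ring. Qed.

HB.instance Definition _ :=
  GRing.Lmodule_isLalgebra.Build R (quat R) qscaleAl.

Lemma qscaleAr (k : R) x y : k *: (x * y) = x * (k *: y).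
Proof. by apply: quat_eq => /=; ring. Qed.

HB.instance Definition _ :=
  GRing.Lalgebra_isAlgebra.Build R (quat R) qscaleAr.

Definition qconj x : quat R := Quat (qr x) (- qi x) (- qj x) (- qk x).

Definition qnormsq x : R := qr x ^+ 2 + qi x ^+ 2 + qj x ^+ 2 + qk x ^+ 2.

Definition qnorm x : R := Num.sqrt (qnormsq x).

Lemma qnormsq_ge0 x : 0 <= qnormsq x.
Proof. by rewrite /qnormsq !addr_ge0 ?sqr_ge0. Qed.

Lemma qnormsq_eq0 x : (qnormsq x == 0) = (x == 0).
Proof.
case: x => a b c d; rewrite /qnormsq /=.
rewrite !paddr_eq0 ?addr_ge0 ?sqr_ge0// !sqrf_eq0 -!andbA.
apply/and4P/eqP => [[/eqP-> /eqP-> /eqP-> /eqP->]//|].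
by case=> -> -> -> ->; rewrite !eqxx.
Qed.

Lemma qnormsqM x y : qnormsq (x * y) = qnormsq x * qnormsq y.
Proof. by rewrite /qnormsq /=; ring. Qed.

Lemma qnormsq_conj x : qnormsq (qconj x) = qnormsq x.
Proof. by rewrite /qnormsq /=; ring. Qed.

Lemma qnormsqD x y :
  qnormsq (x + y) = qnormsq x + qr (qconj x * y) *+ 2 + qnormsq y.
Proof. by rewrite /qnormsq /=; ring. Qed.

Lemma qr_sqr_le x : qr x ^+ 2 <= qnormsq x.
Proof. by rewrite /qnormsq -!addrA lerDl !addr_ge0 ?sqr_ge0. Qed.

Lemma qnormD x y : qnorm (x + y) <= qnorm x + qnorm y.
Proof.
rewrite -(@ler_pXn2r _ 2)// ?nnegrE ?addr_ge0 ?sqrtr_ge0//.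
rewrite sqrrD !sqr_sqrtr ?qnormsq_ge0// qnormsqD lerD2r lerD2l lerMn2r/=.
rewrite -sqrtrM ?qnormsq_ge0// -(qnormsq_conj x) -qnormsqM.
apply: le_trans (ler_norm _) _; rewrite -sqrtr_sqr; apply: ler_wsqrtr.
exact: (qr_sqr_le (qconj x * y)).
Qed.

Lemma qnormZ (k : R) x : qnorm (k *: x) = `|k| * qnorm x.
Proof.
rewrite /qnorm -sqrtr_sqr -sqrtrM ?sqr_ge0//; congr Num.sqrt.
by rewrite /qnormsq /=; ring.
Qed.

Lemma qnorm0_eq0 x : qnorm x = 0 -> x = 0.
Proof.
move=> /eqP; rewrite sqrtr_eq0 => x0; apply/eqP; rewrite -qnormsq_eq0.
by rewrite eq_le x0 qnormsq_ge0.
Qed.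

HB.instance Definition _ :=
  Lmodule_isNormed.Build R (quat R) qnormD qnormZ qnorm0_eq0.

Definition qinv x : quat R := (qnormsq x)^-1 *: qconj x.

Lemma qconj_mul x : qconj x * x = (qnormsq x)%:A.
Proof. by apply: quat_eq => /=; rewrite /qnormsq; ring. Qed.

Lemma qmul_conj x : x * qconj x = (qnormsq x)%:A.
Proof. by apply: quat_eq => /=; rewrite /qnormsq; ring. Qed.

Definition qunit : pred (quat R) := [pred x | x != 0].

Lemma qmulVq : {in qunit, left_inverse 1 qinv *%R}.
Proof.
move=> x x0; rewrite /qinv -scalerAl qconj_mul scalerA mulVf ?scale1r//.
by rewrite qnormsq_eq0.
Qed.

Lemma qmulqV : {in qunit, right_inverse 1 qinv *%R}.
Proof.
move=> x x0; rewrite /qinv -scalerAr qmul_conj scalerA mulVf ?scale1r//.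
by rewrite qnormsq_eq0.
Qed.

Lemma qunitP x y : y * x = 1 /\ x * y = 1 -> qunit x.
Proof.
move=> [yx _]; apply/eqP => x0; move: yx; rewrite x0 mulr0 => /esym/eqP.
by rewrite oner_eq0.
Qed.

Lemma qinv_out : {in [predC qunit], qinv =1 id}.
Proof.
move=> x; rewrite !inE negbK => /eqP->.
by apply: quat_eq; rewrite /= ?oppr0 mulr0.
Qed.

HB.instance Definition _ := GRing.NzRing_hasMulInverse.Build (quat R)
  qmulVq qmulqV qunitP qinv_out.

End Quaternions.

(** * The complexified quaternions *)

(* p + \imath q *)
Record hc (R : realType) : Type := HC { hc1 : quat R; hc2 : quat R }.

Section ComplexifiedQuaternions.
Variable R : realType.
Implicit Types w : hc R.

Definition hc_to_prod w := (hc1 w, hc2 w).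
Definition hc_of_prod (t : quat R * quat R) : hc R := HC t.1 t.2.

Lemma hc_to_prodK : cancel hc_to_prod hc_of_prod.
Proof. by case. Qed.

HB.instance Definition _ := Choice.copy (hc R) (can_type hc_to_prodK).

Lemma hc_eq w1 w2 : hc1 w1 = hc1 w2 -> hc2 w1 = hc2 w2 -> w1 = w2.
Proof. by case: w1 w2 => ? ? [? ?] /= -> ->. Qed.

Definition hczero : hc R := HC 0 0.
Definition hcopp w : hc R := HC (- hc1 w) (- hc2 w).
Definition hcadd w1 w2 : hc R := HC (hc1 w1 + hc1 w2) (hc2 w1 + hc2 w2).

Lemma hcaddA : associative hcadd.
Proof. by move=> *; apply: hc_eq; rewrite /= addrA. Qed.
Lemma hcaddC : commutative hcadd.
Proof. by move=> *; apply: hc_eq; rewrite /= addrC. Qed.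
Lemma hcadd0w : left_id hczero hcadd.
Proof. by move=> *; apply: hc_eq; rewrite /= add0r. Qed.
Lemma hcaddNw : left_inverse hczero hcopp hcadd.
Proof. by move=> *; apply: hc_eq; rewrite /= addNr. Qed.

HB.instance Definition _ :=
  GRing.isZmodule.Build (hc R) hcaddA hcaddC hcadd0w hcaddNw.

Definition hcone : hc R := HC 1 0.
Definition hcmul w1 w2 : hc R :=
  HC (hc1 w1 * hc1 w2 - hc2 w1 * hc2 w2) (hc1 w1 * hc2 w2 + hc2 w1 * hc1 w2).

Lemma hcmulA : associative hcmul.
Proof.
by move=> x y z; apply: hc_eq; apply: quat_eq => /=; ring.
Qed.
Lemma hcmul1w : left_id hcone hcmul.
Proof.
by move=> w; apply: hc_eq; rewrite /= !mul1r !mul0r ?subr0 ?addr0.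
Qed.
Lemma hcmulw1 : right_id hcone hcmul.
Proof.
by move=> w; apply: hc_eq; rewrite /= !mulr1 !mulr0 ?subr0 ?add0r.
Qed.
Lemma hcmulDl : left_distributive hcmul +%R.
Proof.
by move=> *; apply: hc_eq; rewrite /= !mulrDl ?opprD addrACA.
Qed.
Lemma hcmulDr : right_distributive hcmul +%R.
Proof.
by move=> *; apply: hc_eq; rewrite /= !mulrDr ?opprD addrACA.
Qed.
Lemma hcone_neq0 : hcone != 0.
Proof. by apply/eqP => -[] /eqP; rewrite oner_eq0. Qed.

HB.instance Definition _ := GRing.Zmodule_isNzRing.Build (hc R)
  hcmulA hcmul1w hcmulw1 hcmulDl hcmulDr hcone_neq0.

Definition hcscale (k : R) w : hc R := HC (k *: hc1 w) (k *: hc2 w).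

Lemma hcscaleA k l w : hcscale k (hcscale l w) = hcscale (k * l) w.
Proof. by apply: hc_eq; rewrite /= scalerA. Qed.
Lemma hcscale1 : left_id 1 hcscale.
Proof. by move=> w; apply: hc_eq; rewrite /= scale1r. Qed.
Lemma hcscaleDr : right_distributive hcscale +%R.
Proof. by move=> *; apply: hc_eq; rewrite /= scalerDr. Qed.
Lemma hcscaleDl w : {morph hcscale^~ w : k l / k + l}.
Proof. by move=> *; apply: hc_eq; rewrite /= scalerDl. Qed.

HB.instance Definition _ := GRing.Zmodule_isLmodule.Build R (hc R)
  hcscaleA hcscale1 hcscaleDr hcscaleDl.

(* Any norm would do: the space is finite-dimensional and only its topology is
   used. *)
Definition hcnorm w : R := `|hc1 w| + `|hc2 w|.

Lemma hcnormD w1 w2 : hcnorm (w1 + w2) <= hcnorm w1 + hcnorm w2.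
Proof. by rewrite /hcnorm addrACA lerD// ler_normD. Qed.
Lemma hcnormZ (k : R) w : hcnorm (k *: w) = `|k| * hcnorm w.
Proof. by rewrite /hcnorm !normrZ mulrDr. Qed.
Lemma hcnorm0_eq0 w : hcnorm w = 0 -> w = 0.
Proof.
move=> /eqP; rewrite paddr_eq0// !normr_eq0 => /andP[/eqP w1 /eqP w2].
exact: hc_eq.
Qed.

HB.instance Definition _ :=
  Lmodule_isNormed.Build R (hc R) hcnormD hcnormZ hcnorm0_eq0.

Definition imath : hc R := HC 0 1.

Definition hcbar w : hc R := HC (hc1 w) (- hc2 w).

Definition hcconj w : hc R := HC (qconj (hc1 w)) (qconj (hc2 w)).

End ComplexifiedQuaternions.

Arguments imath {R}.

Section SliceFunctions.
Variable R : realType.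

Definition sphere : set (quat R) := [set I | I ^+ 2 = -1].

(* \alpha + I \beta, for z = \alpha + i \beta *)
Definition slice_pt (I : quat R) (z : C R) : quat R :=
  (complex.Re z)%:A + I * (complex.Im z)%:A.

(* F_1 + I F_2, for w = F_1 + \imath F_2 *)
Definition slice_ev (I : quat R) (w : hc R) : quat R := hc1 w + I * hc2 w.

Definition conj_symmetric (D : set (C R)) := forall z, D z -> D (conjc z).

Definition Omega (D : set (C R)) : set (quat R) :=
  [set x | exists I z, [/\ sphere I, D z & x = slice_pt I z]].

Definition domain (U : set (quat R)) := [/\ U !=set0, open U & connected U].

Definition slice_domain (D : set (C R)) :=
  [/\ open D, conj_symmetric D, domain (Omega D)
    & exists t : R, D (Complex t 0)].

(* V_\mathbb{C} *)
Definition complex_trace (V : set (quat R)) : set (C R) :=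
  [set z | exists2 I, sphere I & V (slice_pt I z)].

(** ** Stem functions and slice regularity *)

Definition stem (D : set (C R)) (F : C R -> hc R) :=
  forall z, D z -> F (conjc z) = hcbar (F z).

(* The restrictions of F to the horizontal and the vertical line through z. *)
Definition hline (F : C R -> hc R) (z : C R) : R -> hc R :=
  fun t => F (Complex t (complex.Im z)).
Definition vline (F : C R -> hc R) (z : C R) : R -> hc R :=
  fun t => F (Complex (complex.Re z) t).

Definition dalpha (F : C R -> hc R) (z : C R) : hc R :=
  derive1 (hline F z) (complex.Re z).
Definition dbeta (F : C R -> hc R) (z : C R) : hc R :=
  derive1 (vline F z) (complex.Im z).

Definition stem_C1 (D : set (C R)) (F : C R -> hc R) :=
  forall z, D z ->
    [/\ derivable (hline F z) (complex.Re z) 1,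
        derivable (vline F z) (complex.Im z) 1,
        {for z, continuous (dalpha F)} & {for z, continuous (dbeta F)}].

Definition regular_stem (D : set (C R)) (F : C R -> hc R) :=
  [/\ stem D F, stem_C1 D F
    & forall z, D z -> dalpha F z + imath * dbeta F z = 0].

(* \hat{\mathbb{H}}, with [None] as the point \infty *)
Definition hatH : Type := one_point_compactification (quat R).

(* The functions of the theory are partially defined: [f : quat R -> hatH] is
   only looked at on the circular set under consideration. *)
Definition regular (D : set (C R)) (f : quat R -> hatH) :=
  exists2 F, regular_stem D F &
    forall I z, sphere I -> D z -> f (slice_pt I z) = Some (slice_ev I (F z)).

(** ** Slice product, reciprocal and powers *)

(* The slice product of \mathcal{I}(F) and \mathcal{I}(G) is induced by the
   pointwise product of F and G in [hc R]. *)

Definition stem_conj (F : C R -> hc R) : C R -> hc R := fun z => hcconj (F z).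

Definition stem_normal (F : C R -> hc R) : C R -> hc R :=
  fun z => stem_conj F z * F z.

(* (f^s)^{-1} f^c at the point \alpha + I \beta, for f = \mathcal{I}(F) *)
Definition slice_recip (F : C R -> hc R) (I : quat R) (z : C R) : quat R :=
  (slice_ev I (stem_normal F z))^-1 * slice_ev I (stem_conj F z).

(* f^{*n} at the point \alpha + I \beta, for f = \mathcal{I}(F); for a negative
   n it is (f^{*|n|})^{-*}. *)
Definition slice_pow (F : C R -> hc R) (n : int) (I : quat R) (z : C R) :
    quat R :=
  match n with
  | Posz k => slice_ev I (F z ^+ k)
  | Negz k => slice_recip (fun z => F z ^+ k.+1) I z
  end.

(* the stem function of x |-> x - q *)
Definition stem_sub (q : quat R) : C R -> hc R :=
  fun z => HC ((complex.Re z)%:A - q) (complex.Im z)%:A.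

(** ** Singularities *)

(* In this section a point q = \alpha + I \beta is given by I and
   w = \alpha + i \beta. *)

Definition punctured_disc (w : C R) (r : R) : set (C R) :=
  [set z | 0 < `|z - w| < (r%:C)%C].

Definition A_set (I : quat R) (w : C R) (r : R) : set (quat R) :=
  slice_pt I @` punctured_disc w r.

Definition Omega_set (w : C R) (r : R) : set (quat R) :=
  Omega (punctured_disc w r `&` punctured_disc (conjc w) r).

Definition Sigma_set (I : quat R) (w : C R) (r : R) : set (quat R) :=
  Omega_set w r `|` A_set I w r.

(* f is regular on the circular open set [Omega W], which contains
   \Sigma(q, 0, r). *)
Definition regular_around (f : quat R -> hatH) (I : quat R) (w : C R) (r : R)
    (W : set (C R)) :=
  [/\ 0 < r, open W, conj_symmetric W, regular W f
    & Sigma_set I w r `<=` Omega W].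

(* y is the sum of the series of the u_n over n in \mathbb{Z}. *)
Definition bilateral_sum (u : int -> quat R) (y : quat R) :=
  exists s t, [/\ series (fun n : nat => u (Posz n)) @ \oo --> s,
                  series (fun n : nat => u (Negz n)) @ \oo --> t
                & y = s + t].

Definition laurent_expansion (f : quat R -> hatH) (I : quat R) (w : C R)
    (r : R) (a : int -> quat R) :=
  forall J z, sphere J -> Sigma_set I w r (slice_pt J z) ->
    exists2 y, f (slice_pt J z) = Some y &
      bilateral_sum
        (fun n => slice_pow (stem_sub (slice_pt I w)) n J z * a n) y.

Definition removable (f : quat R -> hatH) (q : quat R) :=
  exists I w r W,
    [/\ sphere I, q = slice_pt I w, regular_around f I w r W
      & exists E g, [/\ open E, conj_symmetric E, W `<=` E /\ Omega E q,
                        regular E g & forall x, Omega W x -> g x = f x]].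

Definition pole (f : quat R -> hatH) (q : quat R) :=
  ~ removable f q /\
  exists I w r W a,
    [/\ sphere I, q = slice_pt I w, regular_around f I w r W,
        laurent_expansion f I w r a
      & exists m : nat, forall k : nat, (m < k)%N -> a (- k%:Z) = 0].

Definition poles (D : set (C R)) (f : quat R -> hatH) : set (quat R) :=
  [set q | Omega D q /\ pole f q].

Definition semiregular (D : set (C R)) (f : quat R -> hatH) :=
  (exists D', [/\ open D', conj_symmetric D', Omega D' `<=` Omega D,
                  regular D' f
                & forall q, (Omega D `\` Omega D') q ->
                    pole f q \/ removable f q]) /\
  (forall q, Omega D q -> (f q = None <-> pole f q)).

Definition constant_on (U : set (quat R)) (f : quat R -> hatH) :=
  exists c, forall x, U x -> f x = c.

End SliceFunctions.

(* Main.v *)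
(* Near a pole or a removable singularity at alpha + I beta, the function is
   regular on a circular set Omega_W containing a punctured disc of C_I around
   that point. By circularity W contains a punctured disc of the complex plane
   around alpha + i beta, so no other pole has its trace there, on whichever
   slice it lies. Hence the trace of the poles is locally finite in D, and its
   intersection with a compact subset of D is finite. *)
Require Import Defs.
From mathcomp Require Import all_boot all_order all_algebra.
From mathcomp Require Import finmap ring lra.
From mathcomp Require Import all_classical all_reals all_analysis.
From mathcomp Require Import complex.
Import Order.TTheory GRing.Theory Num.Theory.
Import numFieldNormedType.Exports.
Local Open Scope classical_set_scope.
Local Open Scope ring_scope.

(** The open sets meeting [A] in finitely many points cover [K]; a finite subcover bounds [A] on [K]
    by a finite union of finite sets. *)
Lemma compact_locally_finite_setI (T : ptopologicalType) (A K : set T) :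
  compact K ->
  (forall z, K z -> exists2 U, nbhs z U & finite_set (A `&` U)) ->
  finite_set (A `&` K).
Proof.
rewrite compact_cover => cK locfin.
have [||E sE KE] :=
    cK _ [set U : set T | open U /\ finite_set (A `&` U)] (fun U => U).
- by move=> U [].
- move=> z /locfin[U]; rewrite nbhsE => -[V [oV Vz] VU] finU.
  by exists V => //; split => //; apply: sub_finite_set finU; exact: setIS.
apply: (@sub_finite_set _ _ (\bigcup_(U in [set` E]) (A `&` U))) _ _.
  by move=> z [Az /KE[U EU Uz]]; exists U.
by apply: bigcup_finite => // U /sE; rewrite inE => -[].
Qed.

Section SliceRegularity.
Context {R : realType}.
Implicit Types (I J : quat R) (z w : C R) (D : set (C R)).

(** Multiplicativity of [qnormsq] gives norm 1. Adding this to the real part of [I ^+ 2 = -1] leaves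
    twice the square of [qr I] equal to 0. *)
Lemma sphere_qr0_qnormsq1 I : sphere I -> qr I = 0 /\ qnormsq I = 1.
Proof.
rewrite /sphere /= expr2 => II.
have n1 : qnormsq I = 1.
  apply/eqP; rewrite -(@eqrXn2 _ 2)// ?qnormsq_ge0// expr1n expr2 -qnormsqM II.
  by rewrite /qnormsq /= oppr0 !expr2; apply/eqP; ring.
split=> //; have := congr1 (@qr R) II.
rewrite /= => rI; apply/eqP; rewrite -sqrf_eq0; apply/eqP.
by move: n1; rewrite /qnormsq; lra.
Qed.

Lemma sphere_i : sphere (Quat 0 1 0 0 : quat R).
Proof. by rewrite /sphere /= expr2; apply: quat_eq => /=; ring. Qed.

(** The real part of alpha + I beta is alpha and its squared norm is alpha^2 + beta^2, so beta is
    determined up to sign. *)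
Lemma slice_pt_inj I J z w : sphere I -> sphere J ->
  slice_pt I z = slice_pt J w -> z = w \/ z = conjc w.
Proof.
move=> /sphere_qr0_qnormsq1[I0 I1] /sphere_qr0_qnormsq1[J0 J1] e.
have qr_pt (L : quat R) u : qr L = 0 -> qr (slice_pt L u) = complex.Re u.
  by move=> L0; rewrite /slice_pt /= L0; ring.
have norm_pt (L : quat R) u : qr L = 0 -> qnormsq (slice_pt L u) =
    complex.Re u ^+ 2 + qnormsq L * complex.Im u ^+ 2.
  by move=> L0; rewrite /slice_pt /qnormsq /= L0; ring.
have eR : complex.Re z = complex.Re w by rewrite -(qr_pt I)// e qr_pt.
have : qnormsq (slice_pt I z) = qnormsq (slice_pt J w) by rewrite e.
rewrite !norm_pt// I1 J1 !mul1r eR => /addrI /eqP; rewrite eqf_sqr.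
by case: z w eR {e} => [a b] [c d] /= -> /orP[]/eqP->; [left|right].
Qed.

Lemma Omega_slice_pt D I z : conj_symmetric D -> sphere I ->
  Omega D (slice_pt I z) -> D z.
Proof.
move=> sD sI [J [w [sJ Dw /slice_pt_inj]]].
by case=> // ->//; exact: sD.
Qed.

Lemma regular_neq_infty D f x : regular D f -> Omega D x -> f x <> None.
Proof. by move=> [F _ fF] [I [z [sI Dz ->]]]; rewrite fF. Qed.

Lemma conj_punctured_disc w r z :
  punctured_disc w r (conjc z) = punctured_disc (conjc w) r z.
Proof.
by rewrite /punctured_disc /= -{1 2}[w]conjcK -!rmorphB !normcJ.
Qed.

Lemma regular_around_punctured_disc f I J w w' r W :
  sphere I -> sphere J -> slice_pt J w = slice_pt I w' ->
  regular_around f I w' r W -> punctured_disc w r `<=` W.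
Proof.
move=> sI sJ e [_ _ sW _ SW].
have W' z : punctured_disc w' r z -> W z.
  by move=> z'; apply: (Omega_slice_pt W I) => //; apply: SW; right; exists z.
move: (slice_pt_inj J I w w' sJ sI e) => [->//|-> z].
by rewrite -conj_punctured_disc => /W'/sW; rewrite conjcK.
Qed.

(** Both kinds of singularity carry the same regularity data, which is all that isolation of the
    poles requires. *)
Lemma pole_or_removable_regular_around f q : pole f q \/ removable f q ->
  exists I w r W, [/\ sphere I, q = slice_pt I w & regular_around f I w r W].
Proof.
by case=> [[_ [I [w [r [W [a []]]]]]]|[I [w [r [W []]]]]]; exists I, w, r, W.
Qed.

Lemma nbhs_punctured_disc w r : 0 < r -> nbhs w (w |` punctured_disc w r).
Proof.
move=> r0; apply/nbhs_ballP; exists (r%:C)%C; first by rewrite /= ltcR.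
move=> z; rewrite -ball_normE /= distrC => zw.
have [->|zw0] := eqVneq z w; first by left.
by right; rewrite /punctured_disc /= normr_gt0 subr_eq0 zw0.
Qed.

Lemma semiregular_poles_isolated D f w : semiregular D f -> D w ->
  exists2 U, nbhs w U & complex_trace (poles D f) `&` U `<=` [set w].
Proof.
move=> [[D' [oD' sD' _ rD' sing]] fpole] Dw.
(* A regular function is finite on every slice over [E], while [f] is infinite at its poles. *)
have no_pole E z : regular E f -> E z -> ~ complex_trace (poles D f) z.
  move=> rE Ez [I sI [OD /(fpole _ OD).2]].
  by apply: regular_neq_infty rE _; exists I, z.
have [D'w|D'w] := pselect (D' w).
  exists D'; first exact: open_nbhs_nbhs.
  by move=> z [pz D'z]; case: (no_pole D' z).
(* The whole sphere over [w] avoids [Omega D'], so any imaginary unit would serve; the quaternion i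
   is taken. *)
have [|J [w' [r [W [sJ e ra]]]]] :=
    pole_or_removable_regular_around f (slice_pt (Quat 0 1 0 0) w).
  apply: sing; split.
    by exists (Quat 0 1 0 0), w; split=> //; exact: sphere_i.
  by move=> /(Omega_slice_pt _ _ _ sD' sphere_i).
have [r0 _ _ rW _] := ra.
(* The centre is added back to obtain a neighbourhood; it is the only point where a pole may
   remain. *)
exists (w |` punctured_disc w r); first exact: nbhs_punctured_disc.
move=> z [pz [//|dz]]; case: (no_pole W z) => //.
exact: (regular_around_punctured_disc _ _ _ _ _ _ _ sJ sphere_i e ra).
Qed.

End SliceRegularity.

Theorem proposition1p31 (R : realType) (D : set (C R)) (f : quat R -> hatH R)
    (K : set (C R)) :
  slice_domain D ->
  semiregular D f ->
  ~ constant_on (Omega D) f ->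
  compact K ->
  K `<=` D ->
  (exists2 z, K z & limit_point K z) ->
  finite_set (complex_trace (poles D f) `&` K).
Proof.
move=> _ sf _ cK KD _; apply: compact_locally_finite_setI => // w /KD Dw.
have [U Uw UP] := semiregular_poles_isolated D f w sf Dw.
by exists U => //; apply: sub_finite_set UP _.
Qed.
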